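(* For each $\alpha \in [-\infty,\infty]$, let $$F(\alpha) := \left\{ x \in (0,1] : \lim_{n\to\infty} \frac{\log d_{n+1}(x)}{\log d_n(x)} = \alpha \right\}.$$ Then $\dim_H F(\alpha) = \alpha^{-1}$ if $\alpha \in [1,\infty]$ (with the convention $\infty^{-1}=0$), and $\dim_H F(\alpha) = 0$ if $\alpha \in [-\infty,1)$, because in the latter case $F(\alpha) = \varnothing$.
   Context: Pierce expansion digits: for $x \in (0,1]$ put $d_1(x) := \lfloor 1/x \rfloor$ and $T(x) := 1 - d_1(x)x$, and for $k \in \mathbb{N}$ put $d_k(x) := d_1(T^{k-1}(x))$ provided $T^{k-1}(x) \neq 0$. All digits $d_k(x)$, $k \in \mathbb{N}$, are defined exactly when $x$ is irrational, and then they form a strictly increasing sequence of positive integers (so $\log d_n(x) > 0$ for $n \geq 2$, and the quotient in the definition of $F(\alpha)$ is finite for $n \ge 2$). Convention: a limiting condition on $(d_n(x))_n$, or a condition for all (large) $n$, is only considered for irrational $x$, so rational $x$ do not belong to sets defined by such conditions. $\mathbb{N}=\{1,2,\dots\}$, $\log$ is the natural logarithm, and $\dim_H$ is the Hausdorff dimension (with $\dim_H \varnothing = 0$). *)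

(* Defs.v *)
From mathcomp Require Export all_boot all_order all_algebra.
From mathcomp Require Export all_classical all_reals all_analysis.

Set Implicit Arguments.
Unset Strict Implicit.
Unset Printing Implicit Defensive.

Export Order.TTheory GRing.Theory Num.Theory numFieldNormedType.Exports.

Local Open Scope classical_set_scope.
Local Open Scope ring_scope.

Section Hausdorff.
Variable R : realType.
Implicit Types (A : set R) (s delta : R).
Local Open Scope ereal_scope.

(* The added element 0 only matters for the empty set: diam set0 = 0. *)
Definition diam A : \bar R :=
  ereal_sup (0 |` [set `|p.1 - p.2|%:E | p in A `*` A]).

(* |A|^s with the convention |set0|^s = 0 for every s, including s = 0;
   for a singleton and s = 0 the value is 0 `^ 0 = 1. *)
Definition diam_pow s A : \bar R :=
  if A == set0 then 0 else diam A `^ s.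

(* Countable covers of A by arbitrary sets of diameter at most delta; finite
   covers are included, since some of the U i may be empty. *)
Definition delta_cover delta A (U : (set R)^nat) : Prop :=
  A `<=` \bigcup_i U i /\ forall i, diam (U i) <= delta%:E.

Definition hausdorff_content delta s A : \bar R :=
  ereal_inf [set \sum_(0 <= i <oo) diam_pow s (U i) | U in delta_cover delta A].

(* The content is nonincreasing in delta, so its limit as delta tends to 0 from
   the right is the supremum. *)
Definition hausdorff_measure s A : \bar R :=
  ereal_sup [set hausdorff_content delta s A | delta in [set delta | (0 < delta)%R]].

Definition hausdorff_dim A : \bar R :=
  ereal_inf [set s%:E | s in [set s | (0 <= s)%R /\ hausdorff_measure s A = 0]].

End Hausdorff.

Section Pierce.
Variable R : realType.
Implicit Types (x : R) (k n : nat) (alpha : \bar R).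

Definition pierce_digit1 x : int := Num.floor (1 / x).

Definition pierce_map x : R := 1 - (pierce_digit1 x)%:~R * x.

(* Digits are numbered from k = 1; the value at k = 0 is irrelevant. The digit
   is meaningful when iter k.-1 pierce_map x != 0, which holds for all k >= 1
   when x in ]0, 1] is irrational. *)
Definition pierce_digit k x : int := pierce_digit1 (iter k.-1 pierce_map x).

Definition log_digit_ratio x n : R :=
  ln (pierce_digit n.+1 x)%:~R / ln (pierce_digit n x)%:~R.

(* Rational numbers have finite expansions and are excluded, since the limit
   makes sense only when all digits are defined. Since / is total, the terms
   where ln (pierce_digit n x) = 0 (only possible for n <= 1) are junk values;
   they do not affect the limit. The limit is taken in \bar R. *)
Definition pierce_ratio_set alpha : set R :=
  [set x | [/\ 0 < x <= 1, irrational x &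
    (log_digit_ratio x n)%:E @[n --> \oo] --> alpha]].

End Pierce.

(* Main.v *)
Require Import Defs.
From mathcomp Require Import ring lra zify.

(** The dimension is bounded from above by covering with neighbourhoods of the
    convergents, and from below by a Cantor set that is an image of the unit
    interval.

    Upper bound.  Let [Q] be the product of the first [n] digits of [x] and let
    [d] be the next digit.  The [n]-th convergent depends only on the set of
    the first [n] digits, and it approximates [x] to within [1 / (Q d)].  If the
    logarithms of the digits grow by a factor tending to [alpha], then [Q d] is
    eventually at least [Q ^ tau] for each [tau < alpha]
    ([ratio_set_growth]).  Digits are distinct, so the convergents can be
    indexed by finite sets of positive integers, and the sum over all such sets
    of [Q ^ (- t)], that is the product of the [1 + k ^ (- t)], converges for
    [t > 1] ([sum_digit_sets_le]).  Hence the [s]-dimensional measure vanishes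
    as soon as [s tau > 1] for some [tau < alpha]
    ([hausdorff_measure_ratio_set_eq0]).  This treats all [alpha >= 1],
    including infinity, at the same time.

    Lower bound.  Choose block sizes [M n] with [ln (M (n + 1)) / ln (M n)]
    tending to [alpha], and let the [n]-th digit run over [[M n, 2 M n)]; all
    resulting points belong to the ratio set.  Writing [y] in [[0, 1)] in mixed
    radix with bases [M n] and using its digits to select Pierce digits defines
    a map [g] from [[0, 1)] to the ratio set.  Two points with different first
    [n] digits are separated by an explicit distance ([orbit_separation]), which
    yields [|y - y'| <= C |g y - g y'| ^ s] whenever [s alpha < 1]
    ([block_digit_holder], [block_size_holder]).  The Lebesgue measure of
    [[0, 1)] being positive, the [s]-dimensional measure of the ratio set is
    not zero ([hausdorff_measure_neq0]).

    For [alpha < 1] the set is empty because digits increase. *)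

Set Implicit Arguments.
Unset Strict Implicit.
Unset Printing Implicit Defensive.

Local Open Scope classical_set_scope.
Local Open Scope ring_scope.

(** * Pierce expansions as orbits *)

Section Orbit.
Variable R : realType.
Implicit Types (x : R) (d : nat -> nat) (u : nat -> R).

(** The digits and the iterates of the Pierce map, linked by the one relation
    [T x = 1 - d x] in a form that is free of the floor function.  Both bounds
    on the dimension are proved for such pairs; the lemmas of this section
    translate to and from the Pierce digits of an irrational number. *)
Definition pierce_orbit d u : Prop :=
  forall n, [/\ (0 < d n < d n.+1)%N, 0 < u n & (d n)%:R * u n = 1 - u n.+1].

Lemma orbit_digit_ge d u n : pierce_orbit d u -> (n < d n)%N.
Proof.
move=> o; elim: n => [|n IH]; first by have [/andP[]] := o 0.
by have [/andP[_ dS] _ _] := o n; exact: leq_ltn_trans IH dS.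
Qed.

Lemma orbit_lt d u n : pierce_orbit d u -> (d n)%:R * u n < 1.
Proof. by move=> o; have [_ _ ->] := o n; have [_] := o n.+1; lra. Qed.

Lemma orbit_le1 d u n : pierce_orbit d u -> u n <= 1.
Proof.
move=> o; have := orbit_lt n o; have [/andP[d0 _] u0 _] := o n.
have : 1 <= (d n)%:R :> R by rewrite ler1n.
nra.
Qed.

Lemma rationalB1M x (d : int) : d != 0 -> rational (1 - d%:~R * x) -> rational x.
Proof.
move=> d0 [q _ qE]; exists ((1 - q) / d%:~R) => //.
rewrite rmorphM rmorphB rmorph1 fmorphV /= ratr_int qE.
rewrite opprB addrCA subrr addr0 mulrC mulKf //.
by rewrite intr_eq0.
Qed.

(** Irrationality is what keeps [T x] away from 0.  The digit grows because
    [T x < x] gives [d * T x < d * x = 1 - T x], so that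
    [(d + 1) * T x < 1]. *)
Lemma pierce_step x : 0 < x <= 1 -> irrational x ->
  let d := pierce_digit1 x in
  [/\ 0 < d, 0 < pierce_map x <= 1, irrational (pierce_map x) &
      d < pierce_digit1 (pierce_map x)].
Proof.
move=> /andP[x0 x1] ix d.
have d0 : 0 < d by rewrite /d floor_gt0 div1r invf_ge1.
have dN0 : d != 0 by rewrite gt_eqF.
have iT : irrational (pierce_map x) by move=> /(rationalB1M dN0).
have xx : x * (1 / x) = 1 by rewrite mulrC divfK // gt_eqF.
have dx : d%:~R * x <= 1 by have := @floor_le R (1 / x); rewrite -/d; nra.
have dx1 : 1 < (d%:~R + 1) * x.
  have /andP[_] := @floor_itv R (1 / x); rewrite -/d intrD; nra.
have d1 : 1 <= d%:~R :> R by rewrite ler1z.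
have T0 : 0 < pierce_map x.
  rewrite lt_neqAle; apply/andP; split; last by rewrite /pierce_map -/d; lra.
  by apply/eqP => T0; apply: iT; rewrite -T0; exists 0; rewrite // rmorph0.
split => //; first by rewrite T0 /pierce_map -/d; nra.
rewrite -lezD1 floor_ge_int intrD div1r -[_ + _]invrK lef_pV2 ?posrE ?invr_gt0; last 2 first.
  by lra.
  by lra.
rewrite -[_^-1]mul1r ler_pdivlMr; last by lra.
by move: T0; rewrite /pierce_map -/d; nra.
Qed.

Lemma irrational_orbit x : 0 < x <= 1 -> irrational x ->
  exists2 d : nat -> nat, (forall n, pierce_digit n.+1 x = d n) &
    pierce_orbit d (fun n => iter n (@pierce_map R) x).
Proof.
move=> x01 ix.
have H n : 0 < iter n (@pierce_map R) x <= 1 /\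
    irrational (iter n (@pierce_map R) x).
  by elim: n => [//|n [IH1 IH2]] /=; have [] := pierce_step IH1 IH2.
exists (fun n => `|pierce_digit n.+1 x|%N) => n.
  by have [/pierce_step p /p[p0 _ _ _]] := H n; rewrite gtz0_abs.
have [/pierce_step p /p[p0 _ _ plt]] := H n.
split.
- by rewrite -!ltz_nat !gtz0_abs // ?p0 // (lt_trans p0).
- by have [/andP[]] := H n.
- rewrite -[_%:R]/((Posz _)%:~R) gtz0_abs //=.
  rewrite /pierce_map /pierce_digit /=; ring.
Qed.

Lemma orbit_digit1 d u n : pierce_orbit d u -> pierce_digit1 (u n) = d n.
Proof.
move=> o; have [/andP[d0 d1] u0 uE] := o n.
have := orbit_lt n.+1 o; have [_ u1 _] := o n.+1.
have : (d n).+1%:R <= (d n.+1)%:R :> R by rewrite ler_nat.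
rewrite -natr1 => dd ul; apply: floor_def.
have {}d0 : 1 <= (d n)%:R :> R by rewrite ler1n.
rewrite intrD ler_pdivlMr // ltr_pdivrMr // -[_%:~R]/((d n)%:R); nra.
Qed.

Lemma orbit_iter d u n : pierce_orbit d u -> iter n (@pierce_map R) (u 0) = u n.
Proof.
move=> o; elim: n => // n /= ->.
by rewrite /pierce_map (orbit_digit1 n o) -[_%:~R]/((d n)%:R);
  have [_ _ ->] := o n; ring.
Qed.

Lemma orbit_pierce_digit d u n :
  pierce_orbit d u -> pierce_digit n.+1 (u 0) = d n.
Proof. by move=> o; rewrite /pierce_digit /= (orbit_iter _ o) (orbit_digit1 _ o). Qed.

(** If [u 0] is a multiple of [1 / b], then so is every [u n], and being
    positive it is at least [1 / b].  This contradicts [u b < 1 / d b] with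
    [b < d b]. *)
Lemma orbit_irrational d u : pierce_orbit d u -> irrational (u 0).
Proof.
move=> o /rationalP[a [b ab]].
have b0 : (0 < b)%N.
  rewrite lt0n; apply/eqP => b0; have [_ + _] := o 0.
  by rewrite ab b0 invr0 mulr0 ltxx.
have bR : 0 < b%:R :> R by rewrite ltr0n.
have [z zE] : exists z : int, u b = z%:~R / b%:R.
  have: forall n, exists z : int, u n = z%:~R / b%:R.
    elim=> [|n [z zE]]; first by exists a.
    have [_ _ E] := o n.
    exists (b%:Z - (d n)%:Z * z); rewrite intrB intrM.
    have -> : u n.+1 = 1 - (d n)%:R * u n by lra.
    by rewrite zE mulrBl divff ?gt_eqF // mulrA.
  by apply.
have [_ ub _] := o b.
have z1 : 1 <= z%:~R :> R.
  by rewrite ler1z -gtz0_ge1 -(ltr0z R); move: ub; rewrite zE pmulr_lgt0 // invr_gt0.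
have ubb : 1 <= b%:R * u b by rewrite zE mulrC divfK // gt_eqF.
have := orbit_lt b o.
have : b%:R <= (d b)%:R :> R by rewrite ler_nat ltnW // (orbit_digit_ge _ o).
nra.
Qed.

(** The value of the finite expansion with the [m] digits
    [d n, ..., d (n + m - 1)]. *)
Fixpoint truncated_orbit d m n : R :=
  if m is m'.+1 then (1 - truncated_orbit d m' n.+1) / (d n)%:R else 0.

(** All digits are at least 2, so one more term changes the truncations by a
    geometrically small amount.  Their limits satisfy the recursion, and they
    are positive because [u (n + 1) <= 1 / 2]. *)
Lemma orbit_exists d : (1 < d 0%N)%N -> (forall n, (d n < d n.+1)%N) ->
  exists u, pierce_orbit d u.
Proof.
move=> d0 dS; pose v := truncated_orbit d.
have d2 n : 2 <= (d n)%:R :> R.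
  by rewrite ler_nat; elim: n => // n /leq_trans; apply; apply/ltnW.
have dn0 n : (d n)%:R != 0 :> R by rewrite gt_eqF // (lt_le_trans _ (d2 n)).
have dinv n : 0 < ((d n)%:R : R)^-1 <= 2^-1.
  by rewrite invr_gt0 lef_pV2 ?posrE // (lt_le_trans _ (d2 n)) //=.
have vS m n : v m.+1 n = (1 - v m n.+1) / (d n)%:R by [].
have v01 m n : 0 <= v m n <= 1.
  elim: m n => [|m IH] n; first by rewrite lexx ler01.
  by rewrite vS; have := IH n.+1; have := dinv n; nra.
have vd m n : `|v m.+1 n - v m n| <= 1 * 2^-1 ^+ m.
  elim: m n => [|m IH] n.
    by rewrite expr0 subr0 mul1r ger0_norm; have := v01 1%N n; lra.
  rewrite !vS -mulrBl normrM.
  have -> : 1 - v m.+1 n.+1 - (1 - v m n.+1) = - (v m.+1 n.+1 - v m n.+1) by ring.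
  rewrite normrN (ger0_norm (x := _^-1)); last by case/andP: (dinv n) => /ltW.
  have := IH n.+1; rewrite exprS !mul1r; have := dinv n.
  by have := normr_ge0 (v m.+1 n.+1 - v m n.+1); nra.
have vc n : cvgn (fun m => v m n).
  have -> : (fun m => v m n) =
      (fun m => v 0%N n + series (telescope (fun m => v m n)) m).
    by apply/funext => m; rewrite -eq_sum_telescope.
  apply: is_cvgD; first exact: is_cvg_cst.
  apply: normed_cvg.
  apply: (@series_le_cvg _ _ (geometric 1 2^-1)).
  - by move=> k; exact: normr_ge0.
  - by move=> k /=; rewrite mul1r exprn_ge0.
  - by move=> k; exact: vd.
  - by apply: is_cvg_geometric_series; rewrite ger0_norm ?invf_lt1 // ltr1n.
pose u n := limn (fun m => v m n).
have uE n : u n = (1 - u n.+1) / (d n)%:R.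
  apply: cvg_lim => //; rewrite -(cvg_shiftS (fun m => v m n)) /=.
  apply: cvgMl; apply: cvgB; first exact: cvg_cst.
  exact: vc.
have u01 n : 0 <= u n <= 1.
  apply/andP; split.
    by apply: limr_ge => //; apply: nearW => m; case/andP: (v01 m n).
  by apply: limr_le => //; apply: nearW => m; case/andP: (v01 m n).
exists u => n; split.
- by rewrite dS andbT -(ltr0n R) (lt_le_trans _ (d2 n)).
- rewrite uE mulr_gt0 //; last by case/andP: (dinv n).
  by rewrite uE; have := dinv n.+1; have := u01 n.+2; nra.
- by rewrite uE mulrC divfK.
Qed.

End Orbit.

(** * A criterion for null Hausdorff measure *)

Section HausdorffZero.
Variable R : realType.
Local Open Scope ereal_scope.

Lemma diam_ge0 (A : set R) : 0 <= diam A.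
Proof. by apply: ereal_sup_ubound; left. Qed.

Lemma diam_le (A : set R) (r : R) : (0 <= r)%R ->
  (forall x y, A x -> A y -> (`|x - y| <= r)%R) -> diam A <= r%:E.
Proof.
move=> r0 H; apply: ge_ereal_sup => _ [->|[[x y] [/= Ax Ay] <-]].
  by rewrite lee_fin.
by rewrite lee_fin H.
Qed.

Lemma dist_le_diam (A : set R) x y : A x -> A y -> (`|x - y|)%:E <= diam A.
Proof. by move=> Ax Ay; apply: ereal_sup_ubound; right; exists (x, y). Qed.

Lemma diam_pow_ge0 s (A : set R) : 0 <= diam_pow s A.
Proof. by rewrite /diam_pow; case: ifP => // _; exact: poweR_ge0. Qed.

Lemma diam_pow_le s (A : set R) (r : R) : (0 <= s)%R -> (0 <= r)%R ->
  diam A <= r%:E -> diam_pow s A <= (r `^ s)%:E.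
Proof.
move=> s0 r0 Ar; rewrite /diam_pow; case: ifP => _.
  by rewrite lee_fin powR_ge0.
rewrite -poweR_EFin; apply: gt0_ler_poweR => //.
  by rewrite in_itv /= diam_ge0 leey.
by rewrite in_itv /= lee_fin r0 leey.
Qed.

Lemma hausdorff_content_ge0 delta s (A : set R) : 0 <= hausdorff_content delta s A.
Proof.
apply: le_ereal_inf_tmp => _ [U _ <-]; apply: nneseries_ge0 => i _ _.
exact: diam_pow_ge0.
Qed.

(** A form of the Borel-Cantelli argument that allows any countable index
    type: it is enough to cover by intervals with centres [c i] and radii
    [r i], the index running over a subset chosen in terms of the precision
    [e].  The pickling of the index type turns such a family into a sequence,
    and partial sums over the sequence become sums over duplicate-free
    lists. *)
Lemma hausdorff_measure_eq0 (T : countType) (s : R) (A : set R) (c r : T -> R) :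
  (0 <= s)%R ->
  (forall e : R, (0 < e)%R -> exists P : pred T,
    [/\ forall i, P i -> (0 <= r i <= e)%R,
        forall x, A x -> exists2 i, P i & (`|x - c i| <= r i)%R &
        forall l, uniq l -> all P l -> (\sum_(i <- l) r i `^ s <= e)%R]) ->
  hausdorff_measure s A = 0.
Proof.
move=> s0 H; apply/eqP; rewrite eq_le; apply/andP; split; last first.
  apply: le_ereal_sup_tmp; exists (hausdorff_content 1 s A).
    by exists 1%R => //=.
  exact: hausdorff_content_ge0.
apply: ge_ereal_sup => _ [delta /= d0 <-].
apply/lee_addgt0Pr => e e0; rewrite add0e.
(* An interval of radius r has diameter 2 r, whence the factors 2 and 2 `^ s. *)
pose k := (2 `^ s : R)%R.
have k0 : (0 < k)%R by rewrite powR_gt0.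
pose e' : R := Num.min (delta / 2)%R (e / k)%R.
have e'0 : (0 < e')%R by rewrite lt_min !divr_gt0.
have [P [Pr PA Ps]] := H _ e'0.
have P2 i : P i -> (2 * r i <= delta)%R.
  by move=> /Pr /andP[_]; rewrite le_min ler_pdivlMr // mulrC => /andP[].
pose U i : set R := if pickle_inv i is Some l then
   if P l then [set x | (`|x - c l| <= r l)%R] else set0 else set0.
pose B l : \bar R := if P l then ((2 * r l) `^ s)%:E else 0.
have dU l : P l -> diam [set x | (`|x - c l| <= r l)%R] <= (2 * r l)%:E.
  move=> /Pr /andP[r0 _]; apply: diam_le; first by rewrite mulr_ge0.
  move=> x y /= xl yl; have -> : (x - y = (x - c l) - (y - c l))%R by ring.
  by rewrite (le_trans (ler_normB _ _)) // mulr_natl mulr2n lerD.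
have d00 : diam (set0 : set R) <= delta%:E by apply: diam_le => //; exact: ltW.
apply: ge_ereal_inf; exists (\sum_(0 <= i <oo) diam_pow s (U i)).
  exists U => //; split.
    move=> x /PA[l Pl xl]; exists (pickle l) => //.
    by rewrite /U pickleK_inv Pl.
  move=> i; rewrite /U; case: pickle_inv => // l; case: ifPn => // Pl.
  by rewrite (le_trans (dU _ Pl)) // lee_fin P2.
apply: lime_le.
  by apply: is_cvg_nneseries => i _ _; exact: diam_pow_ge0.
apply: nearW => n.
apply: (@le_trans _ _ (\sum_(l <- pmap pickle_inv (iota 0 n)) B l)).
  rewrite big_pmap /index_iota subn0; apply: lee_sum => i _.
  rewrite /U; case: pickle_inv => [l|] /=; last by rewrite /diam_pow eqxx.
  rewrite /B; case: ifPn => [Pl|_]; last by rewrite /diam_pow eqxx.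
  by apply: diam_pow_le => //; [rewrite mulr_ge0 //; case/andP: (Pr _ Pl)|exact: dU].
rewrite -big_mkcond /= -big_filter sumEFin lee_fin.
set l := [seq x <- pmap pickle_inv (iota 0 n) | P x].
have Pl : all P l by rewrite filter_all.
have ul : uniq l by rewrite filter_uniq // (pmap_uniq (@pickle_invK _)) // iota_uniq.
have : (\sum_(i <- l) r i `^ s <= e / k)%R.
  by apply: le_trans (Ps l ul Pl) _; rewrite ge_min lexx orbT.
rewrite ler_pdivlMr // mulrC mulr_sumr; apply: le_trans.
rewrite le_eqVlt; apply/orP; left; apply/eqP; apply: eq_big_seq => i il.
have /(Pr _) /andP[r0 _] := allP Pl _ il.
by rewrite powRM.
Qed.

End HausdorffZero.

(** * Summation over all finite sets of digits *)

Section DigitSets.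
Variable R : realType.

Lemma ler_sum_uniq_sub (T : eqType) (F : T -> R) (s s' : seq T) :
  (forall i, 0 <= F i) -> uniq s -> {subset s <= s'} ->
  \sum_(i <- s) F i <= \sum_(i <- s') F i.
Proof.
move=> F0; elim: s s' => [|x s IH] s' /=.
  by move=> _ _; rewrite big_nil sumr_ge0.
case/andP=> xs us ss'.
have xs' : x \in s' by rewrite ss' ?mem_head.
rewrite big_cons (perm_big _ (perm_to_rem xs')) /= big_cons lerD2l IH // => y ys.
have : y \in s' by rewrite ss' // inE ys orbT.
rewrite (perm_mem (perm_to_rem xs')) inE => /predU1P[yx|//].
by move: xs; rewrite -yx ys.
Qed.

(** Finite sets of positive integers at most [m], each represented by its
    strictly decreasing enumeration; the last digit of an expansion comes
    first, which makes the prefixes of an expansion grow at the head. *)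
Fixpoint decreasing_lists m : seq (seq nat) :=
  if m is m'.+1 then
    decreasing_lists m' ++ [seq m :: l | l <- decreasing_lists m'] else [:: [::]].

Lemma mem_decreasing_lists m l :
  sorted gtn l -> all (fun d => 0 < d <= m)%N l -> l \in decreasing_lists m.
Proof.
elim: m l => [|m IH] l sl al.
  by case: l sl al => // d l _ /=; rewrite leqn0; case: d.
rewrite mem_cat; case: l sl al => [|d l] sl al; first by rewrite IH.
move: al => /= /andP[/andP[d0 dm] al].
have dl : all (gtn d) l by apply: order_path_min sl; move=> x y z /=; lia.
have sl' := path_sorted sl.
have [dE|dN] := eqVneq d m.+1.
  apply/orP; right; apply/mapP; exists l; last by rewrite dE.
  apply: IH => //; apply/allP => x xl.
  by have := allP al _ xl; have := allP dl _ xl => /=; lia.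
rewrite IH //=; rewrite d0 andTb; apply/andP; split; first by lia.
apply/allP => x xl.
by have := allP al _ xl; have := allP dl _ xl => /=; lia.
Qed.

Definition digit_prod (l : seq nat) : nat := \prod_(d <- l) d.

Lemma digit_prod_cons d l : digit_prod (d :: l) = (d * digit_prod l)%N.
Proof. by rewrite /digit_prod big_cons. Qed.

(** Expanding the product amounts to choosing, for each [k], whether the digit
    [k + 1] is present. *)
Lemma sum_decreasing_lists (t : R) m :
  \sum_(l <- decreasing_lists m) (digit_prod l)%:R `^ (- t) =
  \prod_(k < m) (1 + k.+1%:R `^ (- t)).
Proof.
elim: m => [|m IH] /=; first by rewrite big_ord0 big_seq1 /digit_prod big_nil powR1.
rewrite big_cat big_map /= big_ord_recr /= mulrDr mulr1 -IH; congr (_ + _).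
rewrite mulr_suml; apply: eq_bigr => l _.
by rewrite digit_prod_cons natrM powRM // mulrC.
Qed.

Lemma ln_ge_subV (y : R) : 0 < y -> 1 - y^-1 <= ln y.
Proof.
move=> y0; rewrite -[y in ln y]invrK lnV ?posrE ?invr_gt0 // lerNr opprB.
have := @expR_ge1Dx R (ln y^-1); rewrite lnK ?posrE ?invr_gt0 //; lra.
Qed.

Lemma gt0_powRD (x r s : R) : 0 < x -> x `^ (r + s) = x `^ r * x `^ s.
Proof. by move=> x0; rewrite powRD // (gt_eqF x0) implybT. Qed.

(** The mean value estimate for [x |-> x `^ (- e)], obtained from
    [expR z >= 1 + z] and [ln y >= 1 - 1 / y] at [y = (k + 2) / (k + 1)]. *)
Lemma powRN_telescope (e : R) k : 0 < e ->
  e * k.+2%:R `^ (- (1 + e)) <= k.+1%:R `^ (- e) - k.+2%:R `^ (- e).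
Proof.
move=> e0.
have k1 : 0 < k.+1%:R :> R by [].
have k2 : 0 < k.+2%:R :> R by [].
pose y : R := k.+2%:R / k.+1%:R.
have y0 : 0 < y by rewrite divr_gt0.
have -> : k.+1%:R `^ (- e) = k.+2%:R `^ (- e) * y `^ e.
  rewrite /y powRM ?invr_ge0 // mulrA -gt0_powRD // addNr powRr0 mul1r.
  by rewrite -powR_inv1 // -powRrM mulN1r.
have -> : k.+2%:R `^ (- (1 + e)) = k.+2%:R `^ (- e) * k.+2%:R^-1.
  by rewrite opprD addrC gt0_powRD // powR_inv1.
rewrite mulrCA -[X in _ - X]mulr1 -mulrBr ler_wpM2l ?powR_ge0 //.
have : 1 + e * ln y <= y `^ e.
  by rewrite /powR gt_eqF // expR_ge1Dx.
have := ln_ge_subV y0.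
have -> : 1 - y^-1 = k.+2%:R^-1.
  by rewrite /y invf_div -(natr1 k.+1); field; rewrite nat1r natr1 pnatr_eq0.
by move=> zl; rewrite lerBrDl; apply: le_trans; rewrite lerD2l ler_wpM2l // ltW.
Qed.

Lemma sum_powRN_le (e : R) m : 0 < e ->
  \sum_(k < m) k.+1%:R `^ (- (1 + e)) <= 1 + e^-1.
Proof.
move=> e0; case: m => [|m].
  by rewrite big_ord0 addr_ge0 // invr_ge0 ltW.
suff : \sum_(k < m.+1) k.+1%:R `^ (- (1 + e)) <= 1 + e^-1 * (1 - m.+1%:R `^ (- e)).
  by move/le_trans; apply; rewrite lerD2l ler_piMr ?invr_ge0 ?(ltW e0) ?gerBl ?powR_ge0.
elim: m => [|m IH]; first by rewrite big_ord1 !powR1 subrr mulr0 addr0.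
rewrite big_ord_recr /=; have := powRN_telescope m e0.
rewrite mulrC -ler_pdivlMr // => H.
by apply: le_trans (lerD IH H) _; rewrite le_eqVlt; apply/orP; left; apply/eqP; ring.
Qed.

Lemma prod_powRN_le (e : R) m : 0 < e ->
  \prod_(k < m) (1 + k.+1%:R `^ (- (1 + e))) <= expR (1 + e^-1).
Proof.
move=> e0; apply: le_trans (_ : expR (\sum_(k < m) k.+1%:R `^ (- (1 + e))) <= _); last first.
  by rewrite ler_expR sum_powRN_le.
rewrite expR_sum; apply: ler_prod => k _.
by rewrite expR_ge1Dx andbT addr_ge0 // powR_ge0.
Qed.

(** Since the digits of an expansion are distinct, the sum over all prefixes of
    all expansions, of every length at once, is bounded by the convergent
    Euler-like product of the factors [1 + k `^ (- (1 + e))]. *)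
Lemma sum_digit_sets_le (e : R) (s : seq (seq nat)) : 0 < e -> uniq s ->
  all (fun l => sorted gtn l && all (ltn 0) l) s ->
  \sum_(l <- s) (digit_prod l)%:R `^ (- (1 + e)) <= expR (1 + e^-1).
Proof.
move=> e0 us als.
pose m := \max_(l <- s) \max_(d <- l) d.
apply: le_trans (prod_powRN_le m e0); rewrite -sum_decreasing_lists.
apply: ler_sum_uniq_sub => // l ls.
have /andP[sl pl] := allP als _ ls.
apply: mem_decreasing_lists => //; apply/allP => d dl.
have /= -> := allP pl _ dl.
by apply: leq_trans (leq_bigmax_seq _ ls isT); apply: leq_bigmax_seq.
Qed.

End DigitSets.

(** * Convergents and their quality of approximation *)

Section Convergents.
Variable R : realType.
Implicit Types (d : nat -> nat) (u : nat -> R).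

Fixpoint history d n : seq nat := if n is n'.+1 then d n' :: history d n' else [::].

Fixpoint convergent (l : seq nat) : R :=
  if l is d :: l' then convergent l' + (-1) ^+ size l' / (digit_prod l)%:R else 0.

Lemma size_history d n : size (history d n) = n.
Proof. by elim: n => //= n ->. Qed.

Lemma orbit_history_sorted d u n : pierce_orbit d u ->
  sorted gtn (history d n) && all (ltn 0) (history d n).
Proof.
move=> o; elim: n => // n /andP[IH1 IH2] /=.
have [/andP[-> _] _ _] := o n; rewrite IH2 andbT.
by case: n IH1 {IH2} => //= n ->; have [/andP[_ ->] _ _] := o n.
Qed.

Lemma digit_prod_history_gt0 d u n : pierce_orbit d u -> (0 < digit_prod (history d n))%N.
Proof.
move=> o; elim: n => [|n IH] /=; first by rewrite /digit_prod big_nil.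
by rewrite digit_prod_cons muln_gt0 IH andbT; have [/andP[]] := o n.
Qed.

Lemma orbit_convergent d u n : pierce_orbit d u ->
  u 0%N - convergent (history d n) =
  (-1) ^+ n * u n / (digit_prod (history d n))%:R.
Proof.
move=> o; elim: n => [|n IH].
  by rewrite /= /digit_prod big_nil expr0 mul1r divr1 subr0.
have [/andP[d0 _] _ uE] := o n.
have Q0 := digit_prod_history_gt0 n o.
rewrite /= opprD addrA IH size_history digit_prod_cons natrM.
have dn : (d n)%:R != 0 :> R by rewrite pnatr_eq0 -lt0n.
have Qn : (digit_prod (history d n))%:R != 0 :> R by rewrite pnatr_eq0 -lt0n.
have -> : u n = (1 - u n.+1) / (d n)%:R by rewrite -uE mulrC mulKf.
by rewrite exprS; field; rewrite dn Qn.
Qed.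

Lemma digit_prod_history_ge d u n : pierce_orbit d u -> (n <= digit_prod (history d n))%N.
Proof.
move=> o; case: n => // n /=; rewrite digit_prod_cons.
by rewrite (leq_trans (orbit_digit_ge n o)) // leq_pmulr // (digit_prod_history_gt0 n o).
Qed.

Lemma orbit_approx d u n : pierce_orbit d u ->
  `|u 0%N - convergent (history d n)| <= ((digit_prod (history d n))%:R * (d n)%:R)^-1.
Proof.
move=> o; rewrite (orbit_convergent n o) !normrM normrX normrN1 expr1n mul1r.
have Q0 := digit_prod_history_gt0 n o.
have [/andP[d0 _] u0 _] := o n.
rewrite gtr0_norm // (ger0_norm (x := _^-1)) ?invr_ge0 // invfM mulrC.
rewrite ler_wpM2l ?invr_ge0 // -[_^-1]mul1r ler_pdivlMr ?ltr0n // mulrC.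
exact/ltW/orbit_lt.
Qed.

(** In logarithmic form, with [a n = ln (d n)] and [S n] the sum of the first
    [n] of them, the claim is [(tau - 1) * S n <= a n].  The hypothesis makes
    [(tau' - 1) * S n - a n] nonincreasing from [N] on, hence bounded, and the
    slack [(tau' - tau) * S n] tends to infinity. *)
Lemma orbit_growth d u (tau tau' : R) N : pierce_orbit d u -> tau < tau' -> 1 < tau' ->
  (forall n, (N <= n)%N -> tau' * ln (d n)%:R <= ln (d n.+1)%:R) ->
  exists M : nat, forall n, (M <= n)%N ->
    (digit_prod (history d n))%:R `^ tau <= (digit_prod (history d n))%:R * (d n)%:R :> R.
Proof.
move=> o tt' t'1 H.
have dR n : 0 < (d n)%:R :> R by rewrite ltr0n; have [/andP[]] := o n.
have QR n : 0 < (digit_prod (history d n))%:R :> R by rewrite ltr0n (digit_prod_history_gt0 n o).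
pose S n : R := ln (digit_prod (history d n))%:R.
have SS n : S n.+1 = ln (d n)%:R + S n.
  by rewrite /S /= digit_prod_cons natrM lnM ?posrE.
have S0 n : 0 <= S n by rewrite ln_ge0 // ler1n (digit_prod_history_gt0 n o).
have a0 n : 0 <= ln (d n)%:R :> R by rewrite ln_ge0 // ler1n; have [/andP[]] := o n.
pose K := (tau' - 1) * S N.
have HK n : (N <= n)%N -> (tau' - 1) * S n - ln (d n)%:R <= K.
  elim: n => [|n IH].
    by rewrite leqn0 => /eqP N0; rewrite /K N0 gerBl.
  rewrite leq_eqVlt => /predU1P[<-|Nn]; first by rewrite /K gerBl.
  by have := IH Nn; have := H n Nn; rewrite SS; lra.
pose M := Num.trunc (expR (K / (tau' - tau))).
exists (maxn N M.+1) => n; rewrite geq_max => /andP[Nn Mn].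
have SK : K <= (tau' - tau) * S n.
  rewrite mulrC -ler_pdivrMr ?subr_gt0 // -ler_expR lnK ?posrE //.
  apply: le_trans (_ : n%:R <= _); last by rewrite ler_nat (digit_prod_history_ge n o).
  have /andP[_ /ltW] := truncn_itv (expR_ge0 (K / (tau' - tau))).
  by move/le_trans; apply; rewrite ler_nat.
have := HK n Nn => HKn.
rewrite /powR gt_eqF // -[X in _ <= X]lnK ?posrE ?mulr_gt0 // ler_expR.
by rewrite lnM ?posrE // -/(S n); lra.
Qed.

End Convergents.

(** * The upper bound *)

Section UpperBound.
Variable R : realType.

Lemma log_digit_ratioE (x : R) (d : nat -> nat) n :
  (forall n, pierce_digit n.+1 x = d n) ->
  log_digit_ratio x n.+1 = ln (d n.+1)%:R / ln (d n)%:R.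
Proof. by move=> dE; rewrite /log_digit_ratio !dE. Qed.

(** For [tau <= 1] the estimate is trivial, so that the case [alpha = 1] needs
    no separate covering of the unit interval. *)
Lemma ratio_set_growth (x tau : R) (alpha : \bar R) (d : nat -> nat)
    (u : nat -> R) :
  (1 <= alpha)%E -> (tau%:E < alpha)%E ->
  (log_digit_ratio x n)%:E @[n --> \oo] --> alpha ->
  (forall n, pierce_digit n.+1 x = d n) -> pierce_orbit d u ->
  exists M : nat, forall n, (M <= n)%N ->
    (digit_prod (history d n))%:R `^ tau <= (digit_prod (history d n))%:R * (d n)%:R :> R.
Proof.
move=> a1 ta cvg dE o.
have [t1|t1] := leP tau 1.
  exists 0%N => n _; have Q0 := digit_prod_history_gt0 n o.
  apply: (@le_trans _ _ (digit_prod (history d n))%:R).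
    by rewrite ler1_powR // ler1n.
  by rewrite ler_peMr // ler1n; have [/andP[]] := o n.
have [t' tt' t'a] : exists2 t', tau < t' & (t'%:E < alpha)%E.
  case: alpha a1 ta cvg => [r| |] //.
    rewrite lte_fin => _ tr _; exists ((tau + r) / 2); rewrite ?lte_fin; lra.
  by move=> _ _ _; exists (tau + 1); rewrite ?ltry //; lra.
have [N _ HN] := cvg _ (open_ereal_gt' t'a).
apply: (@orbit_growth R d u tau t' N.+1 o tt'); first by lra.
move=> n Nn; have := HN n.+1 (leqW (ltnW Nn)).
rewrite /= (log_digit_ratioE _ dE) lte_fin => /ltW.
rewrite ler_pdivlMr // ln_gt0 // ltr1n.
by apply: leq_ltn_trans (orbit_digit_ge n o); case: n Nn.
Qed.

(** Every point lies within [Q `^ (- tau)] of its convergents with digit product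
    [Q], from some rank on.  The [s]-th power of this radius is
    [Q `^ (- e) * Q `^ (- (1 + e))], where the second factor is summable over
    all digit sets and the first one is small once [Q] is large. *)
Lemma hausdorff_measure_ratio_set_eq0 (s tau : R) (alpha : \bar R) :
  (1 <= alpha)%E -> (tau%:E < alpha)%E -> 0 < tau -> 1 < s * tau ->
  hausdorff_measure s (pierce_ratio_set alpha) = 0.
Proof.
move=> a1 ta t0 st.
have s0 : 0 < s by nra.
pose e := (s * tau - 1) / 2.
have e0 : 0 < e by rewrite /e; lra.
apply: (@hausdorff_measure_eq0 R (seq nat) s _ (convergent R)
          (fun l => (digit_prod l)%:R `^ (- tau))); first exact: ltW.
move=> eps eps0.
pose C := expR (1 + e^-1).
have C0 : 0 < C := expR_gt0 _.
pose x1 := (eps `^ (tau^-1))^-1; pose x2 := ((eps / C) `^ (e^-1))^-1.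
have x10 : 0 < x1 by rewrite invr_gt0 powR_gt0.
have x20 : 0 < x2 by rewrite invr_gt0 powR_gt0 // divr_gt0.
(* Digit products above x1 give radii at most eps, and digit products Q above
   x2 make the factor Q `^ (- e) at most eps / C. *)
pose B := (Num.trunc (x1 + x2)).+1.
have BE : x1 + x2 <= B%:R.
  by have /andP[_ /ltW] := truncn_itv (addr_ge0 (ltW x10) (ltW x20)).
have powRV (y p : R) : 0 < y -> 0 < p -> ((y `^ p^-1)^-1) `^ (- p) = y.
  move=> y0 p0; rewrite -powRN -powRrM mulrN mulNr opprK mulVf ?gt_eqF //.
  by rewrite powRr1 // ltW.
have powRNle (y z p : R) : 0 < y -> y <= z -> 0 < p -> z `^ (- p) <= y `^ (- p).
  move=> y0 yz p0; have z0 := lt_le_trans y0 yz.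
  rewrite !powRN lef_pV2 ?posrE ?powR_gt0 //.
  by apply: ge0_ler_powR; rewrite // ?nnegrE ltW.
exists (fun l => [&& sorted gtn l, all (ltn 0) l & (B <= digit_prod l)%N]); split.
- move=> l /and3P[_ _ Bl]; rewrite powR_ge0 /=.
  rewrite -[leRHS](powRV eps tau) //; apply: powRNle => //.
  apply: le_trans (_ : B%:R <= _); last by rewrite ler_nat.
  by apply: le_trans BE; rewrite lerDl ltW.
- move=> x [x01 ix cvg].
  have [d dE o] := irrational_orbit x01 ix.
  have [M HM] := ratio_set_growth a1 ta cvg dE o.
  pose n := maxn M B.
  exists (history d n).
    have /andP[-> ->] /= := orbit_history_sorted n o.
    by rewrite (leq_trans _ (digit_prod_history_ge n o)) // leq_maxr.
  apply: le_trans (orbit_approx n o) _.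
  have Q0 := digit_prod_history_gt0 n o; have [/andP[d0 _] _ _] := o n.
  rewrite powRN lef_pV2 ?posrE ?powR_gt0 ?mulr_gt0 ?ltr0n //.
  by apply: HM; rewrite leq_maxl.
- move=> l ul al.
  have sle : all (fun l => sorted gtn l && all (ltn 0) l) l.
    by apply/allP => i /(allP al) /and3P[-> ->].
  apply: le_trans (_ : \sum_(i <- l) (eps / C) * (digit_prod i)%:R `^ (- (1 + e)) <= _).
    rewrite big_seq [leRHS]big_seq; apply: ler_sum => i il.
    have /and3P[_ _ Bi] := allP al _ il.
    have i0 : 0 < (digit_prod i)%:R :> R by rewrite ltr0n (leq_trans _ Bi).
    have -> : ((digit_prod i)%:R `^ (- tau)) `^ s =
        (digit_prod i)%:R `^ (- e) * (digit_prod i)%:R `^ (- (1 + e)) :> R.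
      by rewrite -powRrM -gt0_powRD //; congr powR; rewrite /e; field.
    rewrite ler_wpM2r ?powR_ge0 // -[leRHS](powRV _ e) // ?divr_gt0 //.
    apply: powRNle => //.
    apply: le_trans (_ : B%:R <= _); last by rewrite ler_nat.
    by apply: le_trans BE; rewrite lerDr ltW.
  rewrite -mulr_sumr mulrAC ler_pdivrMr // ler_pM2l //.
  exact: sum_digit_sets_le.
Qed.

End UpperBound.

(** * A mass distribution principle *)

Section MassDistribution.
Variable R : realType.
Local Open Scope ereal_scope.

Lemma le_diam_pow s (A : set R) x y : (0 <= s)%R -> A x -> A y ->
  (`|x - y| `^ s)%:E <= diam_pow s A.
Proof.
move=> s0 Ax Ay; rewrite /diam_pow ifF; last first.
  by apply/eqP => A0; rewrite A0 in Ax.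
rewrite -poweR_EFin; apply: gt0_ler_poweR => //.
- by rewrite in_itv /= lee_fin normr_ge0 leey.
- by rewrite in_itv /= diam_ge0 leey.
- exact: dist_le_diam.
Qed.

(** The inverse of [g] is Hoelder continuous of exponent [s], so a cover of [A]
    pulls back to a cover of [[0, 1)] by sets whose diameters are at most [C]
    times the [s]-th powers of the original ones.  Each of these sets, when it
    is nonempty, is enclosed in an interval centred at one of its points, and
    subadditivity of Lebesgue measure bounds the sum from below. *)
Lemma hausdorff_measure_neq0 (A : set R) (s C : R) (g : R -> R) :
  (0 <= s)%R -> (0 < C)%R ->
  (forall y, (0 <= y < 1)%R -> A (g y)) ->
  (forall y y', (0 <= y < 1)%R -> (0 <= y' < 1)%R ->
    (`|y - y'| <= C * `|g y - g y'| `^ s)%R) ->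
  hausdorff_measure s A != 0.
Proof.
move=> s0 C0 gA gC.
suff H : ((2 * C)^-1)%:E <= hausdorff_measure s A.
  by rewrite gt_eqF // (lt_le_trans _ H) // lte_fin invr_gt0 mulr_gt0.
apply: le_ereal_sup_tmp; exists (hausdorff_content 1 s A); first by exists 1%R => /=.
apply: le_ereal_inf_tmp => _ [U [AU dU] <-].
have fU i : diam_pow s (U i) \is a fin_num.
  rewrite ge0_fin_numE ?diam_pow_ge0 //.
  by apply: le_lt_trans (diam_pow_le s0 _ (dU i)) _ => //; rewrite ltry.
pose L i := (C * fine (diam_pow s (U i)))%R.
have L0 i : (0 <= L i)%R by rewrite mulr_ge0 ?fine_ge0 ?diam_pow_ge0 // ltW.
pose V i : set R := if pselect (exists2 a, (0 <= a < 1)%R & U i (g a)) is left e then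
  `[(projT1 (cid2 e) - L i)%R, (projT1 (cid2 e) + L i)%R]%classic else set0.
have V0 i y : (0 <= y < 1)%R -> U i (g y) -> V i y.
  move=> y01 Uy; rewrite /V; case: pselect => [e|]; last by case; exists y.
  case: cid2 => a /= a01 Ua.
  have := gC _ _ y01 a01.
  have : (`|g y - g a| `^ s <= fine (diam_pow s (U i)))%R.
    by rewrite -lee_fin fineK // le_diam_pow.
  rewrite -(ler_pM2l C0) -/(L i) => H1 H2; have := le_trans H2 H1.
  by rewrite in_itv /= ler_norml; lra.
have mV i : measurable (V i) by rewrite /V; case: pselect => // e; exact: measurable_itv.
have lV i : lebesgue_measure (V i) <= (2 * C)%:E * diam_pow s (U i).
  rewrite -(fineK (fU i)) -EFinM -mulrA -/(L i).
  rewrite /V; case: pselect => [e|_]; last by rewrite measure0 lee_fin mulr_ge0.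
  rewrite lebesgue_measure_itv /=; case: ifP => _; last by rewrite lee_fin mulr_ge0.
  by rewrite -EFinB lee_fin; lra.
have : lebesgue_measure (`[0%R, 1%R[%classic : set R) <=
    \sum_(0 <= i <oo) lebesgue_measure (V i).
  apply: measure_sigma_subadditive => //.
  move=> y /=; rewrite in_itv /= => y01.
  by have [i _ Ui] := AU _ (gA _ y01); exists i => //; exact: V0.
rewrite lebesgue_measure_itv /= lte_fin ltr01 sube0 => H.
have {}H : 1 <= (2 * C)%:E * \sum_(0 <= i <oo) diam_pow s (U i).
  rewrite -nneseriesZl; last by move=> *; exact: diam_pow_ge0.
  by apply: le_trans H _; apply: lee_nneseries => i *; [exact: measure_ge0|exact: lV].
have C20 : (0 < (2 * C)^-1)%R by rewrite invr_gt0 mulr_gt0.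
move: H; rewrite -(@lee_pmul2l _ ((2 * C)^-1)%:E) // ?lte_fin // mule1.
by rewrite muleA -EFinM mulVf ?mul1e // gt_eqF // mulr_gt0.
Qed.

End MassDistribution.

(** * Points with different digits are far apart *)

Section Separation.
Variable R : realType.
Implicit Types (d : nat -> nat) (u : nat -> R).

Lemma eq_history d d' n : (forall k, (k < n)%N -> d k = d' k) ->
  history d n = history d' n.
Proof.
elim: n => //= n IH H; rewrite H // IH // => k kn.
by apply: H; exact: leqW.
Qed.

(** After the common digits the difference is that of [u n] and [u' n], divided
    by the product of those digits.  As [u n = (1 - u (n + 1)) / d n] and
    [u' n < 1 / d' n], the only loss is [u (n + 1)], which the large digit
    [d (n + 1)] makes at most [1 / (2 d' n)]: half of the gap between
    [1 / d n] and [1 / d' n] survives. *)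
Lemma orbit_separation d d' u u' n :
  pierce_orbit d u -> pierce_orbit d' u' ->
  (forall k, (k < n)%N -> d k = d' k) -> (d n < d' n)%N ->
  (2 * d' n <= d n.+1)%N ->
  ((d' n)%:R - (d n)%:R) /
    (2 * (d n)%:R * (d' n)%:R * (digit_prod (history d n))%:R) <= `|u 0%N - u' 0%N|.
Proof.
move=> o o' dd' ltd led.
have E := orbit_convergent n o; have E' := orbit_convergent n o'.
rewrite -(eq_history dd') in E'.
have -> : u 0%N - u' 0%N = (-1) ^+ n * ((u n - u' n) / (digit_prod (history d n))%:R).
  have -> : u 0%N - u' 0%N = (u 0%N - convergent R (history d n)) -
     (u' 0%N - convergent R (history d n)) by ring.
  by rewrite E E'; ring.
rewrite !normrM normrX normrN1 expr1n mul1r.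
have Q0 : 0 < (digit_prod (history d n))%:R :> R by rewrite ltr0n (digit_prod_history_gt0 n o).
rewrite (ger0_norm (x := _^-1)) ?invr_ge0 ?(ltW Q0) // invfM mulrA ler_wpM2r ?invr_ge0 ?(ltW Q0) //.
apply: le_trans (ler_norm _).
have [/andP[d0 _] u0 uE] := o n; have [/andP[d'0 _] _ _] := o' n.
have := orbit_lt n.+1 o; have := orbit_lt n o'.
have [_ u10 _] := o n.+1; have [_ u'0 _] := o' n.
move: d0 d'0 ltd led; rewrite -(ltr0n R) -[(0 < d' n)%N](ltr0n R) -(ler_nat R) -natr1
  -(ler_nat R) natrM.
set D := (d n)%:R; set D' := (d' n)%:R; set D1 := (d n.+1)%:R => D0 D'0 ltd led h1 h2.
rewrite ler_pdivrMr ?mulr_gt0 //.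
have k1 : 2 * D' * u n.+1 < 1 by nra.
have k2 : 2 * D' * (D * u n) > 2 * D' - 1 by rewrite uE; nra.
have k3 : 2 * D * (D' * u' n) < 2 * D by nra.
nra.
Qed.

End Separation.

(** * Mixed radix expansions *)

Section MixedRadix.
Variables (R : realType) (M : nat -> nat).
Hypothesis M1 : forall n, (1 < M n)%N.

Fixpoint radix_rem (y : R) n : R :=
  if n is n'.+1 then
    (M n')%:R * radix_rem y n' - (Num.trunc ((M n')%:R * radix_rem y n'))%:R
  else y.

Definition radix_digit y n : nat := Num.trunc ((M n)%:R * radix_rem y n).

Definition radix_prod n : nat := \prod_(k < n) M k.

Lemma radix_prodS n : radix_prod n.+1 = (radix_prod n * M n)%N.
Proof. by rewrite /radix_prod big_ord_recr. Qed.

Lemma radix_prod_ge n : (2 ^ n <= radix_prod n)%N.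
Proof.
elim: n => [|n IH]; first by rewrite /radix_prod big_ord0.
by rewrite radix_prodS expnSr leq_mul.
Qed.

Lemma radix_prod_gt0 n : (0 < radix_prod n)%N.
Proof. by apply: leq_trans (radix_prod_ge n); rewrite expn_gt0. Qed.

Lemma radix_rem_itv y n : 0 <= y < 1 -> 0 <= radix_rem y n < 1.
Proof.
move=> y01; elim: n => //= n /andP[IH _].
have /truncn_itv : 0 <= (M n)%:R * radix_rem y n by rewrite mulr_ge0.
by rewrite -natr1; lra.
Qed.

Lemma radix_digit_lt y n : 0 <= y < 1 -> (radix_digit y n < M n)%N.
Proof.
move=> /(radix_rem_itv n) /andP[y0 y1].
rewrite truncn_lt_nat ?mulr_ge0 // gtr_pMr // ltr0n.
exact: ltnW.
Qed.

Lemma radix_expansion y y' n :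
  (forall k, (k < n)%N -> radix_digit y k = radix_digit y' k) ->
  y - y' = (radix_rem y n - radix_rem y' n) / (radix_prod n)%:R.
Proof.
elim: n => [|n IH] H; first by rewrite /radix_prod big_ord0 divr1.
rewrite IH; last by move=> k kn; apply: H; exact: leqW.
have := H n (ltnSn n); rewrite /radix_digit /= => ->.
rewrite radix_prodS natrM opprB addrA subrK -mulrBr.
have M0 : (M n)%:R != 0 :> R by rewrite pnatr_eq0 -lt0n ltnW.
have P0 : (radix_prod n)%:R != 0 :> R by rewrite pnatr_eq0 -lt0n radix_prod_gt0.
by field; rewrite M0 P0.
Qed.

Lemma radix_inj y y' : 0 <= y < 1 -> 0 <= y' < 1 ->
  (forall k, radix_digit y k = radix_digit y' k) -> y = y'.
Proof.
move=> y01 y'01 H; apply/eqP; rewrite -subr_eq0 -normr_eq0; apply/negP => /negP yy'.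
have {}yy' : 0 < `|y - y'| by rewrite lt_neqAle eq_sym yy' normr_ge0.
pose n := (Num.trunc `|y - y'|^-1).+1.
have nE : `|y - y'|^-1 < n%:R.
  by have /andP[] : _ := truncn_itv (ltW (etrans (invr_gt0 _) yy')).
have : `|y - y'| * (radix_prod n)%:R < 1.
  rewrite (radix_expansion (n := n)) // normrM normfV (ger0_norm (x := _%:R)) //.
  rewrite divfK; last by rewrite pnatr_eq0 -lt0n radix_prod_gt0.
  have := radix_rem_itv n y01; have := radix_rem_itv n y'01.
  by rewrite ltr_norml; lra.
apply/negP; rewrite -leNgt -ler_pdivrMl // mulr1 (le_trans (ltW nE)) // ler_nat.
exact: leq_trans (ltnW (ltn_expl n (ltnSn 1))) (radix_prod_ge n).
Qed.

Lemma radix_dist_le y y' n : 0 <= y < 1 -> 0 <= y' < 1 ->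
  (forall k, (k < n)%N -> radix_digit y k = radix_digit y' k) ->
  (radix_digit y n < radix_digit y' n)%N ->
  `|y - y'| <= 2 * ((radix_digit y' n)%:R - (radix_digit y n)%:R) /
    (radix_prod n.+1)%:R.
Proof.
move=> y01 y'01 H; rewrite -(ler_nat R) -natr1 => lt.
have := radix_rem_itv n.+1 y01; have := radix_rem_itv n.+1 y'01.
rewrite /= -!/(radix_digit _ _) => r' r.
rewrite (radix_expansion H) radix_prodS natrM.
have M0 : 0 < (M n)%:R :> R by rewrite ltr0n ltnW.
have P0 : 0 < (radix_prod n)%:R :> R by rewrite ltr0n radix_prod_gt0.
have -> : (radix_rem y n - radix_rem y' n) / (radix_prod n)%:R =
  ((M n)%:R * radix_rem y n - (M n)%:R * radix_rem y' n) /
    ((radix_prod n)%:R * (M n)%:R).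
  by field; rewrite !gt_eqF.
rewrite normrM (ger0_norm (x := _^-1)) ?invr_ge0 ?mulr_ge0 // ler_wpM2r //.
by rewrite ler_norml; lra.
Qed.

End MixedRadix.

(** * Transfer from mixed radix digits to Pierce digits *)

Section Holder.
Variables (R : realType) (M : nat -> nat).
Hypothesis M1 : forall n, (1 < M n)%N.
Hypothesis M4 : forall n, (4 * M n <= M n.+1)%N.

(** The [n]-th Pierce digit ranges over the block [[M n, 2 * M n)], within which
    the mixed radix digit in base [M n] selects it. *)
Definition block_digit (y : R) n : nat := (M n + radix_digit M y n)%N.

Lemma block_digit_itv y n : 0 <= y < 1 -> (M n <= block_digit y n < 2 * M n)%N.
Proof.
move=> y01; have := radix_digit_lt M1 n y01; rewrite /block_digit; lia.
Qed.

Lemma block_digit_orbit y : 0 <= y < 1 ->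
  exists u : nat -> R, pierce_orbit (block_digit y) u.
Proof.
move=> y01; apply: orbit_exists.
  by have := block_digit_itv 0 y01; have := M1 0; lia.
move=> n; have := block_digit_itv n y01; have := block_digit_itv n.+1 y01.
by have := M4 n; lia.
Qed.

Lemma digit_prod_block_digit_le y n : 0 <= y < 1 ->
  (digit_prod (history (block_digit y) n) <= 2 ^ n * radix_prod M n)%N.
Proof.
move=> y01; elim: n => [|n IH] /=; first by rewrite /digit_prod /radix_prod big_nil big_ord0.
rewrite digit_prod_cons radix_prodS expnS mulnACA [(2 ^ n * _)%N]mulnC mulnCA.
have /andP[_ /ltnW H] := block_digit_itv n y01.
have := leq_mul H IH; lia.
Qed.

(** At the first index [n] where the digits differ, let [w] be the difference
    of the digits divided by [M n].  With [P] the product of the first [n]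
    bases, [y] and [y'] are at distance at most [2 * w / P], and the points of
    the Cantor set are at distance at least [w / W], where [W] is the quantity
    whose [s]-th power is bounded in the hypothesis.  As [w <= 1], one has
    [w <= w `^ s], and the two estimates combine. *)
Lemma block_digit_holder (s K : R) y y' u u' :
  0 <= s <= 1 -> 0 < K ->
  (forall n, (2 ^ n.+3 * radix_prod M n.+1)%:R `^ s <= K * (radix_prod M n)%:R) ->
  0 <= y < 1 -> 0 <= y' < 1 ->
  pierce_orbit (block_digit y) u -> pierce_orbit (block_digit y') u' ->
  `|y - y'| <= 2 * K * `|u 0%N - u' 0%N| `^ s.
Proof.
move=> s01 K0 HK.
have main (z z' : R) n v v' : 0 <= z < 1 -> 0 <= z' < 1 ->
    pierce_orbit (block_digit z) v -> pierce_orbit (block_digit z') v' ->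
    (forall k, (k < n)%N -> radix_digit M z k = radix_digit M z' k) ->
    (radix_digit M z n < radix_digit M z' n)%N ->
    `|z - z'| <= 2 * K * `|v 0%N - v' 0%N| `^ s.
  move=> z01 z'01 o o' eqd ltd.
  apply: le_trans (radix_dist_le M1 z01 z'01 eqd ltd) _.
  have /andP[b1 b2] := block_digit_itv n z01.
  have /andP[b1' b2'] := block_digit_itv n z'01.
  have ltb : (block_digit z n < block_digit z' n)%N by rewrite ltn_add2l.
  have leb : (2 * block_digit z' n <= block_digit z n.+1)%N.
    by have /andP[] := block_digit_itv n.+1 z01; have := M4 n; lia.
  have eqb k : (k < n)%N -> block_digit z k = block_digit z' k.
    by move=> kn; rewrite /block_digit eqd.
  have sep := orbit_separation o o' eqb ltb leb.
  have Qle := digit_prod_block_digit_le n z01; have Q0 := digit_prod_history_gt0 n o.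
  have -> : (radix_digit M z' n)%:R - (radix_digit M z n)%:R =
      (block_digit z' n)%:R - (block_digit z n)%:R :> R.
    by rewrite /block_digit !natrD; ring.
  have b0 : (0 < block_digit z n)%N by have [/andP[]] := o n.
  set m : R := _ - _ in sep *.
  have m0 : 0 < m by rewrite subr_gt0 ltr_nat.
  have mM : m <= (M n)%:R.
    by rewrite lerBlDl -natrD ler_nat; move: b1 b2'; lia.
  have M0 : 0 < (M n)%:R :> R by rewrite ltr0n ltnW.
  pose P : R := (radix_prod M n)%:R.
  have P0 : 0 < P by rewrite ltr0n radix_prod_gt0.
  pose W : R := (2 ^ n.+3 * radix_prod M n.+1)%:R.
  have W0 : 0 < W by rewrite ltr0n muln_gt0 expn_gt0 radix_prod_gt0.
  pose w := m / (M n)%:R.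
  have w0 : 0 < w by rewrite divr_gt0.
  have w1 : w <= 1 by rewrite ler_pdivrMr // mul1r.
  have {}sep : w / W <= `|v 0%N - v' 0%N|.
    apply: le_trans sep; rewrite /w -mulrA -invfM ler_pM2l // lef_pV2 ?posrE ?mulr_gt0 // ?ltr0n //.
      rewrite /W -!natrM ler_nat radix_prodS !expnS.
      have -> : (M n * (2 * (2 * (2 * 2 ^ n)) * (radix_prod M n * M n)) =
          2 * (2 * M n * (2 * M n) * (2 ^ n * radix_prod M n)))%N by ring.
      have := leq_mul (leq_mul (ltnW b2) (ltnW b2')) Qle.
      by rewrite -(leq_pmul2l (m := 2)) // !mulnA.
    exact: ltn_trans b0 ltb.
  have sepP : (w / W) `^ s <= `|v 0%N - v' 0%N| `^ s.
    apply: ge0_ler_powR; rewrite ?nnegrE //; first by case/andP: s01.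
    by rewrite divr_ge0 // ltW.
  have ws : w <= w `^ s by apply: ger1_powR; rewrite ?w0 //; case/andP: s01.
  apply: (@le_trans _ _ (2 * K * (w / (K * P)))).
    rewrite radix_prodS natrM -/P le_eqVlt; apply/orP; left; apply/eqP.
    by rewrite /w; field; rewrite !gt_eqF.
  rewrite ler_pM2l ?mulr_gt0 //; apply: le_trans sepP.
  rewrite powRM ?invr_ge0 ?(ltW w0) ?(ltW W0) //.
  have Ws : 0 < W `^ s by rewrite powR_gt0.
  have -> : W^-1 `^ s = (W `^ s)^-1.
    by rewrite -powR_inv1 ?(ltW W0) // -powRrM mulN1r powRN.
  have KP0 : 0 < K * P by rewrite mulr_gt0.
  apply: ler_pM; rewrite ?invr_ge0 ?(ltW KP0) ?(ltW w0) //.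
  by rewrite lef_pV2 ?posrE //; exact: HK.
move=> y01 y'01 o o'.
have [[k dk]|nd] := pselect (exists k, radix_digit M y k != radix_digit M y' k); last first.
  have -> : y = y'.
    apply: (radix_inj M1) => // k; apply/eqP/negPn/negP => dk.
    by apply: nd; exists k.
  by rewrite subrr normr0 mulr_ge0 ?powR_ge0 ?mulr_ge0 // ltW.
pose n := ex_minn (ex_intro (fun k => radix_digit M y k != radix_digit M y' k) k dk).
have [dn eqd] : radix_digit M y n != radix_digit M y' n /\
    forall i, (i < n)%N -> radix_digit M y i = radix_digit M y' i.
  rewrite /n; case: ex_minnP => j dj minj; split => // i ij.
  by apply/eqP/negPn/negP => /minj; rewrite leqNgt ij.
move: dn; rewrite neq_ltn => /orP[lt|lt]; first exact: (main _ _ n).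
rewrite distrC [X in _ <= _ * X `^ s]distrC; apply: (main _ _ n) => // i ij.
by rewrite eqd.
Qed.

End Holder.

(** * Block sizes with logarithmic ratio alpha *)

Section BlockSizes.
Variables (R : realType) (alpha : R).

(** The summand [n' + 3] makes the exponents grow quadratically even for
    [alpha = 1], while it stays negligible with respect to them, so that the
    quotient of consecutive exponents tends to [alpha]. *)
Fixpoint block_exp n : nat :=
  if n is n'.+1 then (Num.trunc (alpha * (block_exp n')%:R) + n'.+3)%N else 1%N.

Definition block_size n : nat := (2 ^ block_exp n)%N.

Lemma block_exp_itv n : 1 <= alpha ->
  alpha * (block_exp n)%:R + n%:R + 2 <= (block_exp n.+1)%:R
    <= alpha * (block_exp n)%:R + n%:R + 3.
Proof.
move=> alpha1.
have /truncn_itv : 0 <= alpha * (block_exp n)%:R.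
  by rewrite mulr_ge0 // (le_trans _ alpha1).
rewrite [block_exp n.+1]/= natrD -natr1 -(natr1 n.+2) -(natr1 n.+1) -(natr1 n); lra.
Qed.

Lemma block_expS_ge n : 1 <= alpha -> (block_exp n + n + 3 <= block_exp n.+1)%N.
Proof.
move=> alpha1; rewrite /= -addnA leq_add //; last by lia.
rewrite truncn_ge_nat; last by rewrite mulr_ge0 // (le_trans _ alpha1).
by rewrite ler_peMl.
Qed.

Lemma block_exp_ge n : 1 <= alpha -> (n.+1 * n.+2 <= 2 * block_exp n)%N.
Proof.
move=> alpha1; elim: n => [|n IH]; first by [].
by have := block_expS_ge n alpha1; lia.
Qed.

Lemma block_exp_gt0 n : 1 <= alpha -> (0 < block_exp n)%N.
Proof. by move=> alpha1; have := block_exp_ge n alpha1; lia. Qed.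

Lemma block_size_gt1 n : 1 <= alpha -> (1 < block_size n)%N.
Proof.
by move=> alpha1; rewrite /block_size -(expn0 2) ltn_exp2l // block_exp_gt0.
Qed.

Lemma block_sizeS n : 1 <= alpha -> (4 * block_size n <= block_size n.+1)%N.
Proof.
move=> alpha1; rewrite /block_size -[4%N]/(2 ^ 2)%N -expnD leq_exp2l //.
by have := block_expS_ge n alpha1; lia.
Qed.

Lemma block_size_ratio (d : nat -> nat) : 1 <= alpha ->
  (forall n, (block_size n <= d n < 2 * block_size n)%N) ->
  ln (d n.+1)%:R / ln (d n)%:R @[n --> \oo] --> alpha.
Proof.
move=> alpha1 dM.
have aux (m a : R) : 0 <= m -> (m + 1) * (m + 1 + 1) <= 2 * a ->
    (m + 4 + alpha) * (m + 1) <= 2 * (2 + alpha) * a.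
  move=> m0 ma; have am : 0 <= alpha * m by nra.
  have H1 : (2 + alpha) * ((m + 1) * (m + 1 + 1)) <= (2 + alpha) * (2 * a).
    by rewrite ler_wpM2l //; lra.
  have H2 : (m + 4 + alpha) * (m + 1) <= (2 + alpha) * (m + 1 + 1) * (m + 1).
    by rewrite ler_wpM2r //; lra.
  by lra.
have ln2 : 0 < ln 2 :> R by rewrite ln_gt0 // ltr1n.
have lnME n : ln (block_size n)%:R = (block_exp n)%:R * ln 2 :> R.
  by rewrite /block_size natrX lnXn // mulr_natl.
have lnd n : (block_exp n)%:R * ln (2 : R) <= ln (d n)%:R <= ((block_exp n)%:R + 1) * ln (2 : R).
  have /andP[d1 d2] := dM n.
  have M0 : (0 < block_size n)%N := ltnW (block_size_gt1 n alpha1).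
  have d0 := leq_trans M0 d1.
  have -> : ((block_exp n)%:R + 1) * ln (2 : R) = ln (2 * block_size n)%:R.
    by rewrite natrM lnM ?posrE ?ltr0n // lnME mulrDl mul1r addrC.
  by rewrite -lnME !ler_ln ?posrE ?ltr0n ?muln_gt0 // !ler_nat d1 ltnW.
(* The error is at most (n + 4 + alpha) / block_exp n, and block_exp n is at
   least (n + 1) (n + 2) / 2. *)
pose K : R := 2 * (2 + alpha).
apply: (@squeeze_cvgr _ _ _ _ (fun n => alpha - K * harmonic n)
   (fun n => alpha + K * harmonic n)); last 2 first.
- rewrite -[X in _ --> X]subr0 -[X in _ - X](mulr0 K).
  by apply: cvgB; [exact: cvg_cst|apply: cvgMr; exact: cvg_harmonic].
- rewrite -[X in _ --> X]addr0 -[X in _ + X](mulr0 K).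
  by apply: cvgD; [exact: cvg_cst|apply: cvgMr; exact: cvg_harmonic].
apply: nearW => n /=.
have a0 : 1 <= (block_exp n)%:R :> R by rewrite ler1n block_exp_gt0.
have l0 : 0 < ln (d n)%:R :> R 
  by case/andP: (lnd n) => + _; apply: lt_le_trans; rewrite mulr_gt0 // (lt_le_trans ltr01).
have KE : n%:R + 4 + alpha <= K / n.+1%:R * (block_exp n)%:R.
  rewrite mulrAC ler_pdivlMr //.
  have := block_exp_ge n alpha1; rewrite -(ler_nat R) !natrM -(natr1 n.+1) -(natr1 n) => ge.
  exact: aux.
set h := K / n.+1%:R in KE *.
have h0 : 0 <= h by rewrite divr_ge0 // mulr_ge0 //; lra.
rewrite ler_pdivlMr // ler_pdivrMr //.
have := lnd n; have := lnd n.+1; have := block_exp_itv n alpha1.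
move: a0 KE l0; set a : R := (block_exp n)%:R; set a' : R := (block_exp n.+1)%:R.
set l := ln (d n)%:R; set l' := ln (d n.+1)%:R; set L := ln 2 in ln2 *.
set m : R := n%:R => a0 KE l0 /andP[r1 r2] /andP[l'1 l'2] /andP[l1 l2].
have m0 : 0 <= m by rewrite /m.
have hl : h * a * L <= h * l by rewrite -mulrA ler_wpM2l.
have k1 : (m + 4 + alpha) * L <= h * l by apply: le_trans hl; rewrite ler_wpM2r // ltW.
have k2 : alpha * a * L <= alpha * l by rewrite -mulrA ler_wpM2l // (le_trans _ alpha1).
have k3 : alpha * l <= alpha * a * L + alpha * L.
  have -> : alpha * a * L + alpha * L = alpha * ((a + 1) * L) by ring.
  by rewrite ler_wpM2l // (le_trans _ alpha1).
have k4 : (alpha * a + m + 2) * L <= a' * L by rewrite ler_wpM2r // ltW.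
have k5 : a' * L <= (alpha * a + m + 3) * L by rewrite ler_wpM2r // ltW.
have k6 : 0 <= m * L by rewrite mulr_ge0 // ltW.
have k7 : 0 <= alpha * L by rewrite mulr_ge0 // ?ltW // (lt_le_trans _ alpha1).
by apply/andP; split; lra.
Qed.

(** The quotient of the two sides gets multiplied by
    [(2 * M (n + 1)) `^ s / M n] when [n] increases.  Since the logarithm of
    [M (n + 1)] is about [alpha] times that of [M n] and [s * alpha < 1], this
    factor is eventually at most 1, and the quotient is bounded. *)
Lemma block_size_holder (s : R) : 1 <= alpha -> 0 <= s -> s * alpha < 1 ->
  exists2 K, 0 < K & forall n,
    (2 ^ n.+3 * radix_prod block_size n.+1)%:R `^ s <=
      K * (radix_prod block_size n)%:R :> R.
Proof.
move=> alpha1 s0 sa.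
pose f n : R := (2 ^ n.+3 * radix_prod block_size n.+1)%:R `^ s /
  (radix_prod block_size n)%:R.
have P0 n : 0 < (radix_prod block_size n)%:R :> R.
  by rewrite ltr0n radix_prod_gt0 // => k; exact: block_size_gt1.
have f0 n : 0 <= f n by rewrite divr_ge0 // powR_ge0.
(* From N on, s (block_exp (n + 1) + 1) <= block_exp n. *)
pose N := (Num.trunc (4 * s / (1 - s * alpha))).+1.
have NE : 4 * s <= (1 - s * alpha) * N%:R.
  rewrite -ler_pdivrMl ?subr_gt0 // mulrC.
  have : 0 <= 4 * s / (1 - s * alpha) by rewrite divr_ge0 ?mulr_ge0 // subr_ge0 ltW.
  by move=> /truncn_itv /andP[_ /ltW].
have step n : (N <= n)%N -> (2 * block_size n.+1)%:R `^ s <= (block_size n)%:R :> R.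
  move=> Nn.
  rewrite /block_size -expnS !natrX -!powR_mulrn // -powRrM.
  apply: ler_powR; first by rewrite ler1n.
  have := block_exp_ge n alpha1; rewrite -(ler_nat R) !natrM -(natr1 n.+1) -(natr1 n) => ge.
  have := block_exp_itv n alpha1; rewrite -(natr1 (block_exp n.+1)).
  have NR : N%:R <= n%:R :> R by rewrite ler_nat.
  set a : R := (block_exp n)%:R in ge *; set a' : R := (block_exp n.+1)%:R.
  move=> /andP[_ r2].
  have c0 : 0 < 1 - s * alpha by rewrite subr_gt0.
  have n0 : 0 <= n%:R :> R by [].
  have h1 : s * (a' + 1) <= s * (alpha * a + n%:R + 4) by rewrite ler_wpM2l //; lra.
  have h2 : s * 4 <= (1 - s * alpha) * (n%:R + 1) by nra.
  have h3 : (1 - s * alpha) * ((n%:R + 1) * (n%:R + 1 + 1)) <= (1 - s * alpha) * (2 * a).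
    by rewrite ler_wpM2l // ltW.
  have h4 : s * 4 * (n%:R + 2) <= (1 - s * alpha) * (n%:R + 1) * (n%:R + 2).
    by rewrite ler_wpM2r //; lra.
  have h5 : 0 <= s * n%:R by rewrite mulr_ge0.
  nra.
have fS n : (N <= n)%N -> f n.+1 <= f n.
  move=> Nn; rewrite /f (radix_prodS _ n.+1) expnS.
  have -> : (2 * 2 ^ n.+3 * (radix_prod block_size n.+1 * block_size n.+1))%N =
    (2 ^ n.+3 * radix_prod block_size n.+1 * (2 * block_size n.+1))%N by lia.
  rewrite natrM powRM // {2}radix_prodS [X in _ / X]natrM invfM.
  rewrite mulrACA ler_piMr //.
  by rewrite ler_pdivrMr ?mul1r ?step // ltr0n ltnW // block_size_gt1.
pose K := 1 + \sum_(k < N.+1) f k.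
have K0 : 0 < K by rewrite ltr_pwDl // sumr_ge0.
exists K => // n; rewrite -ler_pdivrMr // -/(f n).
have small k : (k <= N)%N -> f k <= K.
  move=> kN; rewrite /K (bigD1 (inord k)) //= inordK //.
  by rewrite addrCA lerDl addr_ge0 // sumr_ge0.
have [/small //|/ltnW] := leqP n N.
elim: n => [|n IH] ; first by rewrite leqn0 => /eqP N0; apply: small; rewrite N0.
rewrite leq_eqVlt => /predU1P[E|Nn]; first by apply: small; rewrite E.
by apply: le_trans (fS _ Nn) (IH Nn).
Qed.

End BlockSizes.

(** * The dimension of the ratio sets *)

Section Dimension.
Variable R : realType.
Local Open Scope ereal_scope.

Lemma hausdorff_measure_ratio_set_neq0 (alpha s : R) :
  (1 <= alpha)%R -> (0 <= s)%R -> (s * alpha < 1)%R ->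
  hausdorff_measure s (pierce_ratio_set alpha%:E) != 0.
Proof.
move=> a1 s0 sa.
have M1 n := block_size_gt1 n a1; have M4 n := block_sizeS n a1.
have [K K0 HK] := block_size_holder a1 s0 sa.
have /choice[u uP] : forall y : R, exists v : nat -> R, (0 <= y < 1)%R ->
    pierce_orbit (block_digit (block_size alpha) y) v.
  move=> y; have [y01|yn] := boolP (0 <= y < 1)%R; last by exists (fun=> 0%R).
  by have [v vP] := block_digit_orbit M1 M4 y01; exists v.
apply: (@hausdorff_measure_neq0 _ _ s (2 * K) (fun y => u y 0%N)) => //.
- by rewrite mulr_gt0.
- move=> y y01; have o := uP _ y01; split.
  + by rewrite (orbit_le1 _ o) andbT; have [_ ->] := o 0%N.
  + exact: orbit_irrational o.
  + apply: cvg_EFin; first by apply: nearW.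
    rewrite -cvg_shiftS /=.
    under eq_fun do rewrite (log_digit_ratioE _ (fun k => orbit_pierce_digit k o)).
    apply: block_size_ratio => // n.
    exact: block_digit_itv.
- move=> y y' y01 y'01.
  apply: (block_digit_holder M1 M4 _ K0 HK y01 y'01 (uP _ y01) (uP _ y'01)).
  by rewrite s0 /=; nra.
Qed.

(** Strictly increasing digits have logarithmic ratios at least 1. *)
Lemma pierce_ratio_set_lt1 (alpha : \bar R) : alpha < 1 ->
  pierce_ratio_set alpha = set0.
Proof.
move=> a1; rewrite -subset0 => x [x01 ix cvg].
have [d dE o] := irrational_orbit x01 ix.
have [N _ HN] := cvg _ (open_ereal_lt' a1).
have := HN N.+2 (leqW (leqnSn N)).
rewrite /= (log_digit_ratioE _ dE) lte_fin ltNge => /negP; apply.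
have d1 : (1 < d N.+1)%N by apply: leq_ltn_trans (orbit_digit_ge N.+1 o).
have dS : (d N.+1 <= d N.+2)%N by rewrite ltnW //; have [/andP[]] := o N.+1.
rewrite ler_pdivlMr ?mul1r ?ln_gt0 ?ltr1n //.
by rewrite ler_ln ?posrE ?ltr0n ?ler_nat // ltnW // (leq_trans d1).
Qed.

Lemma hausdorff_dim_ge0 (A : set R) : 0 <= hausdorff_dim A.
Proof. by apply: le_ereal_inf_tmp => _ [s [s0 _] <-]; rewrite lee_fin. Qed.

Lemma hausdorff_dim_set0 : hausdorff_dim (set0 : set R) = 0.
Proof.
apply/eqP; rewrite eq_le hausdorff_dim_ge0 andbT.
apply: ge_ereal_inf; exists 0 => //; exists 0%R => //; split => //.
apply: (@hausdorff_measure_eq0 R nat 0 set0 (fun=> 0%R) (fun=> 0%R)) => // e e0.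
exists pred0; split => // l _; rewrite all_pred0 => /nilP ->.
by rewrite big_nil ltW.
Qed.

End Dimension.

Lemma hausdorff_dim_ratio_set (R : realType) (alpha : \bar R) : (1 <= alpha)%E ->
  hausdorff_dim (pierce_ratio_set alpha) = (alpha^-1)%E.
Proof.
move=> a1; have up (s : R) : 0 < s -> (s^-1%:E < alpha)%E ->
    (hausdorff_dim (pierce_ratio_set alpha) <= s%:E)%E.
  move=> s0 sa.
  have [tau t1 t2] : exists2 tau, s^-1 < tau & (tau%:E < alpha)%E.
    case: alpha a1 sa => [r _| |] //.
      by rewrite lte_fin => sr; exists ((s^-1 + r) / 2); rewrite ?lte_fin; lra.
    by move=> _ _; exists (s^-1 + 1); rewrite ?ltry //; lra.
  apply: ge_ereal_inf; exists s%:E => //; exists s => //; split; first exact: ltW.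
  apply: (@hausdorff_measure_ratio_set_eq0 R s tau) => //.
    by apply: lt_trans t1; rewrite invr_gt0.
  by rewrite mulrC -ltr_pdivrMr // div1r.
case: alpha a1 up => [r| |] //.
- rewrite lee_fin => r1 up.
  have r0 : 0 < r by lra.
  rewrite inver gt_eqF //; apply/eqP; rewrite eq_le; apply/andP; split.
    apply/lee_addgt0Pr => e e0; rewrite -EFinD.
    have ri : 0 < r^-1 by rewrite invr_gt0.
    apply: up; first by rewrite addr_gt0.
    by rewrite lte_fin invf_plt ?posrE ?addr_gt0 // ltrDl.
  apply: le_ereal_inf_tmp => _ [s [s0 Hs] <-]; rewrite lee_fin leNgt.
  apply/negP => sr; have sr1 : s * r < 1 by rewrite -ltr_pdivlMr // div1r.
  by have := hausdorff_measure_ratio_set_neq0 r1 s0 sr1; rewrite Hs eqxx.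
- move=> _ up; rewrite invey; apply/eqP; rewrite eq_le hausdorff_dim_ge0 andbT.
  by apply/lee_addgt0Pr => e e0; rewrite add0e; apply: up => //; rewrite ltry.
Qed.

Local Open Scope ereal_scope.

(* (+oo)^-1 = 0 for the inverse of extended reals. *)
Theorem theorem1p12 (R : realType) (alpha : \bar R) :
  (1 <= alpha -> hausdorff_dim (pierce_ratio_set alpha) = alpha^-1) /\
  (alpha < 1 ->
    pierce_ratio_set alpha = set0 /\
    hausdorff_dim (pierce_ratio_set alpha) = 0).
Proof.
split=> [|a1]; first exact: hausdorff_dim_ratio_set.
by rewrite pierce_ratio_set_lt1 // hausdorff_dim_set0.
Qed.
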